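(* Consider a sequence (indexed by $n\to\infty$) of attributed Erdős–Rényi pairs $\mathcal{G}(n,\bm p;m,\bm q)$, where $m$, $\bm p$, $\bm q$ may depend on $n$. Let $\psi_{\mathrm u}=(\sqrt{p_{11}p_{00}}-\sqrt{p_{10}p_{01}})^2$ and $\psi_{\mathrm a}=(\sqrt{q_{11}q_{00}}-\sqrt{q_{10}q_{01}})^2$. If $$\tfrac12 n\psi_{\mathrm u}+m\psi_{\mathrm a}-\log n\to+\infty \quad (n\to\infty),$$ then the MAP estimator achieves exact alignment with high probability, i.e. $\lim_{n\to\infty}\mathsf P(\hat\pi_{\mathrm{MAP}}(G_1,G_2')\ne\Pi^* )=0$.
   Context: Attributed Erdős–Rényi pair $\mathcal{G}(n,\bm p;m,\bm q)$: two random graphs $G_1,G_2$ on a common vertex set consisting of $n$ user vertices $\mathcal V_{\mathrm u}=[n]$ and $m$ attribute vertices $\mathcal V_{\mathrm a}$ (disjoint from $\mathcal V_{\mathrm u}$). Let $\mathcal E_{\mathrm u}$ be the set of (unordered) pairs of distinct users and $\mathcal E_{\mathrm a}=\mathcal V_{\mathrm u}\times\mathcal V_{\mathrm a}$; there are no edges between attribute vertices. $G_k(e)\in\{0,1\}$ indicates whether $e$ is an edge of $G_k$. Independently over $e\in\mathcal E_{\mathrm u}\cup\mathcal E_{\mathrm a}$, $\mathsf P((G_1(e),G_2(e))=(a,b))=p_{ab}$ for $e\in\mathcal E_{\mathrm u}$ and $=q_{ab}$ for $e\in\mathcal E_{\mathrm a}$ ($a,b\in\{0,1\}$), where $\bm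 p=(p_{11},p_{10},p_{01},p_{00})$ and $\bm q=(q_{11},q_{10},q_{01},q_{00})$ are probability vectors. Standing assumption: $G_1(e)$ and $G_2(e)$ are positively correlated for every $e$ (correlation coefficient defined and $>0$). Anonymization: $\Pi^*$ is uniform on the set $\mathcal S_n$ of permutations of $[n]$, independent of $(G_1,G_2)$, and $G_2'$ is obtained from $G_2$ by relabeling each user $i$ as $\Pi^*(i)$ (attribute vertices keep their labels). An estimator is a function $\hat\pi(G_1,G_2')\in\mathcal S_n$. The MAP estimator $\hat\pi_{\mathrm{MAP}}(G_1,G_2')$ is a maximizer over $\pi\in\mathcal S_n$ of the posterior $\mathsf P(\Pi^*=\pi\mid G_1,G_2')$. *)

(* Defs.v *)
(* All the random objects are finite, so laws are probability mass functions on
   finite types. *)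
From mathcomp Require Import all_boot all_order all_algebra all_fingroup.
From mathcomp Require Import reals.

Set Implicit Arguments.
Unset Strict Implicit.
Unset Printing Implicit Defensive.

Import Order.TTheory GRing.Theory Num.Theory.
Local Open Scope ring_scope.

Section FiniteProbability.
Variables (R : realType) (T : finType) (mu : T -> R).

Definition is_pmf : Prop := (forall x, 0 <= mu x) /\ \sum_x mu x = 1.

Definition Pr (A : pred T) : R := \sum_(x | A x) mu x.

(* Equal to 0 when [Pr B = 0], since [0^-1 = 0]. *)
Definition cPr (A B : pred T) : R := Pr (predI A B) / Pr B.

Definition Ex (X : T -> R) : R := \sum_x mu x * X x.

Definition Cov (X Y : T -> R) : R :=
  Ex (fun x => (X x - Ex X) * (Y x - Ex Y)).

Definition Var (X : T -> R) : R := Cov X X.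

Definition corr (X Y : T -> R) : R :=
  Cov X Y / (Num.sqrt (Var X) * Num.sqrt (Var Y)).

(* The two variance conditions say that the coefficient is defined. *)
Definition pos_correlated (X Y : T -> R) : Prop :=
  [/\ 0 < Var X, 0 < Var Y & 0 < corr X Y].

End FiniteProbability.

Section Graphs.
Variables n m : nat.

Definition user_edge : Type := {e : {set 'I_n} | #|e| == 2}.

(* There are no edges between attributes. *)
Definition edge : Type := (user_edge + 'I_n * 'I_m)%type.

(* The indicator of the edge set. *)
Definition graph : Type := {ffun edge -> bool}.

Lemma relabel_user_subproof (s : 'S_n) (e : user_edge) :
  #|s @: val e| == 2.
Proof. by rewrite card_imset; [exact: valP e | exact: perm_inj]. Qed.

Definition relabel_edge (s : 'S_n) (e : edge) : edge :=
  match e with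
  | inl u => inl (exist _ (s @: val u) (relabel_user_subproof s u))
  | inr (i, a) => inr (s i, a)
  end.

(* Renaming user i as s i: the new graph takes at [relabel_edge s e] the value
   that the old one takes at e. *)
Definition relabel (s : 'S_n) (g : graph) : graph :=
  [ffun e => g (relabel_edge s^-1%g e)].

End Graphs.

Section AttributedErdosRenyi.
Variables (R : realType) (n m : nat).
(* [p (a, b)] is p_ab. *)
Variables p q : bool * bool -> R.

Definition edge_law (e : edge n m) : bool * bool -> R :=
  match e with inl _ => p | inr _ => q end.

(* An outcome is (G1, G2, Pi). *)
Definition outcome : Type := (graph n m * graph n m * 'S_n)%type.

Definition G1 (w : outcome) : graph n m := w.1.1.
Definition G2 (w : outcome) : graph n m := w.1.2.
Definition Pi (w : outcome) : 'S_n := w.2.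
Definition G2' (w : outcome) : graph n m := relabel (Pi w) (G2 w).

(* Independent pairs (G1 e, G2 e) with law [edge_law e], and an independent
   uniform permutation. *)
Definition aER (w : outcome) : R :=
  (\prod_(e : edge n m) edge_law e (G1 w e, G2 w e)) * (n`!%:R)^-1.

Lemma aER_pmf : is_pmf p -> is_pmf q -> is_pmf aER.
Proof.
move=> [p0 p1] [q0 q1]; split=> [w|].
  by rewrite mulr_ge0 ?invr_ge0 ?ler0n// prodr_ge0// => -[].
pose F (g : graph n m * graph n m) : R :=
  \prod_(e : edge n m) edge_law e (g.1 e, g.2 e).
have F1 : \sum_g F g = 1.
  pose h (g : graph n m * graph n m) : {ffun edge n m -> bool * bool} :=
    [ffun e => (g.1 e, g.2 e)].
  pose k (f : {ffun edge n m -> bool * bool}) : graph n m * graph n m :=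
    ([ffun e => (f e).1], [ffun e => (f e).2]).
  transitivity (\prod_(e : edge n m) \sum_ab edge_law e ab).
    rewrite bigA_distr_bigA (reindex h) /=; last first.
      exists k => [[g g']|f] _.
        by congr pair; apply/ffunP => e; rewrite !ffunE.
      by apply/ffunP => e; rewrite !ffunE -surjective_pairing.
    apply: eq_bigr => g _; apply: eq_bigr => e _; by rewrite ffunE.
  by rewrite big1// => -[].
rewrite -(pair_bigA _ (fun g s => F g * (n`!%:R)^-1)) /=.
rewrite -[RHS]F1; apply: eq_bigr => g _.
rewrite sumr_const -[LHS]mulr_natr -mulrA card_Sn mulVf ?mulr1//.
by rewrite pnatr_eq0 -lt0n fact_gt0.
Qed.

Definition estimator : Type := graph n m -> graph n m -> 'S_n.

Definition posterior (g1 g2' : graph n m) (s : 'S_n) : R :=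
  cPr aER (fun w => Pi w == s) (fun w => (G1 w == g1) && (G2' w == g2')).

(* Nothing is required at observations of probability 0, where every posterior
   value is 0; ties may be broken arbitrarily. *)
Definition is_MAP (pihat : estimator) : Prop :=
  forall g1 g2' s, posterior g1 g2' s <= posterior g1 g2' (pihat g1 g2').

Definition error_probability (pihat : estimator) : R :=
  Pr aER (fun w => pihat (G1 w) (G2' w) != Pi w).

End AttributedErdosRenyi.

Definition edges_pos_correlated (R : realType) (n m : nat)
    (p q : bool * bool -> R) : Prop :=
  forall e : edge n m, pos_correlated (edge_law p q e)
    (fun ab => (ab.1 : nat)%:R) (fun ab => (ab.2 : nat)%:R).

Definition psi (R : realType) (r : bool * bool -> R) : R :=
  (Num.sqrt (r (true, true) * r (false, false))
   - Num.sqrt (r (true, false) * r (false, true))) ^+ 2.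

(* Main.v *)
Require Import Defs.
From mathcomp Require Import all_boot all_order all_algebra all_fingroup.
From mathcomp Require Import reals ring lra.

Import Order.TTheory GRing.Theory Num.Theory.
Local Open Scope ring_scope.

(* A wrong MAP answer costs at most sqrt (P(w) P(w')), where w' is the outcome
   with the same observation and the answered permutation, so the error
   probability is at most the sum over permutations t <> 1 of the Bhattacharyya
   coefficient of the pair (G1, G2) and the pair with G2 relabeled by t. Summing
   out G1, that coefficient is a sum over g of the products of N_e (g e) (g (t e))
   over all edges e, where N_e = S^T S and S = (sqrt P_ab); N_e has trace 1 and
   squared Frobenius norm 1 - 2 psi. No cycle decomposition is needed: every
   variable g e occurs in exactly two factors, so eliminating the variables one
   by one with Cauchy-Schwarz bounds the coefficient by the product of
   sqrt (1 - 2 psi) <= exp (- psi) over the edges moved by t. If t moves k users,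
   it moves at least k (n - 2) / 2 user edges and exactly k m attribute edges;
   there are at most n^k such t, and the resulting geometric series has ratio at
   most e exp (- (n psi_u / 2 + m psi_a - log n)). *)

Set Implicit Arguments.
Unset Strict Implicit.
Unset Printing Implicit Defensive.

(** * Cauchy-Schwarz inequalities for finite sums *)

Lemma cauchy_schwarz_sum (R : realDomainType) (C : finType) (x y : C -> R) :
  (\sum_c x c * y c) ^+ 2 <= (\sum_c x c ^+ 2) * (\sum_c y c ^+ 2).
Proof.
(* Lagrange's identity: this double sum is twice the gap between the two sides. *)
have : 0 <= \sum_c \sum_d (x c * y d - x d * y c) ^+ 2.
  by apply: sumr_ge0 => c _; apply: sumr_ge0 => d _; exact: sqr_ge0.
have -> : \sum_c \sum_d (x c * y d - x d * y c) ^+ 2 =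
    (\sum_c x c ^+ 2) * (\sum_c y c ^+ 2) *+ 2
    - (\sum_c x c * y c) ^+ 2 *+ 2.
  rewrite mulr2n {2}[(\sum_c x c ^+ 2) * _]mulrC expr2 !big_distrlr /=.
  rewrite -big_split -sumrMnl -sumrB; apply: eq_bigr => c _ /=.
  rewrite -big_split -sumrMnl -sumrB; apply: eq_bigr => d _ /=; ring.
by rewrite -mulrnBl pmulrn_lge0// subr_ge0.
Qed.

Lemma cauchy_schwarz_sqrt (R : rcfType) (C : finType) (x y : C -> R) :
  (forall c, 0 <= x c) -> (forall c, 0 <= y c) ->
  \sum_c Num.sqrt (x c) * Num.sqrt (y c)
    <= Num.sqrt (\sum_c x c) * Num.sqrt (\sum_c y c).
Proof.
move=> x0 y0; have S0 : 0 <= \sum_c x c by apply: sumr_ge0.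
rewrite -sqrtrM// -[leLHS]ger0_norm; last first.
  by apply: sumr_ge0 => c _; rewrite mulr_ge0 ?sqrtr_ge0.
rewrite -sqrtr_sqr ler_wsqrtr// (le_trans (cauchy_schwarz_sum _ _))//.
under eq_bigr do rewrite sqr_sqrtr//.
by under [X in _ * X <= _]eq_bigr do rewrite sqr_sqrtr//.
Qed.

(** * Partial sums and elimination of variables *)

Section PartialSums.
Variables (R : rcfType) (V C : finType).
Implicit Types (A D : {set V}) (g h : {ffun V -> C}) (G : {ffun V -> C} -> R).

Definition update g x c : {ffun V -> C} :=
  [ffun y => if y == x then c else g y].

Definition agree_off A g h := [forall y, (y \notin A) ==> (h y == g y)].

Lemma agree_offP A g h :
  reflect (forall y, y \notin A -> h y = g y) (agree_off A g h).
Proof.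
apply: (iffP forallP) => [H y yA|H y]; first exact/eqP/(implyP (H y)).
by apply/implyP => yA; apply/eqP/H.
Qed.

(** Freezing the other coordinates at [g] keeps every partial sum a function on all of [V], so the
    index type never changes as [A] shrinks. *)
Definition psum A g G : R := \sum_(h | agree_off A g h) G h.

Definition depends_on D G := forall g h, {in D, g =1 h} -> G g = G h.

Lemma psum_ge0 A g G : (forall h, 0 <= G h) -> 0 <= psum A g G.
Proof. by move=> G0; apply: sumr_ge0. Qed.

Lemma psum0 g G : psum set0 g G = G g.
Proof.
rewrite /psum (big_pred1 g)// => h; apply/agree_offP/eqP => [H|->//].
by apply/ffunP => y; rewrite H ?inE.
Qed.

Lemma psumT g G : psum setT g G = \sum_h G h.
Proof.
by apply: eq_bigl => h; apply/agree_offP => y; rewrite inE.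
Qed.

Lemma psumU1 A g G x : x \notin A ->
  psum (x |: A) g G = \sum_c psum A (update g x c) G.
Proof.
move=> xA; rewrite /psum (partition_big (fun h : {ffun V -> C} => h x) xpredT)//=.
apply: eq_bigr => c _; apply: eq_bigl => h.
apply/andP/agree_offP => [[/agree_offP H /eqP hx] y yA|H].
  by rewrite ffunE; case: eqVneq => [->//|yx]; rewrite H// !inE negb_or yx.
split; last by rewrite H// ffunE eqxx.
apply/agree_offP => y; rewrite !inE negb_or => /andP[yx yA].
by rewrite H// ffunE (negbTE yx).
Qed.

Lemma psum1 g G x : psum [set x] g G = \sum_c G (update g x c).
Proof.
by rewrite -[[set x]]setU0 psumU1 ?inE//; apply: eq_bigr => c _; rewrite psum0.
Qed.

Lemma eq_psum A D g h G : A \subset D -> depends_on D G ->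
  {in D, g =1 h} -> psum A g G = psum A h G.
Proof.
move=> AD dG gh.
have [mrg mrgE] : exists f : {ffun V -> C} -> {ffun V -> C} -> {ffun V -> C},
    forall k k' y, f k k' y = if y \in A then k y else k' y.
  exists (fun k k' => [ffun y => if y \in A then k y else k' y]) => k k' y.
  by rewrite ffunE.
have mrgK k : agree_off A g k -> mrg (mrg k h) g = k.
  move=> /agree_offP H. apply/ffunP => y; rewrite !mrgE.
  by case: (boolP (y \in A)) => // yA; rewrite H.
rewrite /psum (reindex_onto (fun k => mrg k g) (fun k => mrg k h)) //=.
have e k : agree_off A g (mrg k g) && (mrg (mrg k g) h == k) = agree_off A h k.
  apply/andP/agree_offP => [[_ /eqP H] y yA|H].
    by rewrite -H !mrgE (negbTE yA).
  split; first by apply/agree_offP => y yA; rewrite mrgE (negbTE yA).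
  apply/eqP/ffunP => y; rewrite !mrgE.
  by case: (boolP (y \in A)) => // yA; rewrite H.
rewrite (eq_bigl _ _ e); apply: eq_bigr => k /agree_offP H; apply: dG => y yD.
by rewrite mrgE; case: (boolP (y \in A)) => // yA; rewrite H// gh.
Qed.

(* Finner's generalized Hoelder inequality when every variable occurs in exactly
   the two factors [u x] and [v x]. *)
Lemma finner (I : finType) (D : I -> {set V}) (F : I -> {ffun V -> C} -> R)
    (u v : V -> I) A g :
    (forall i h, 0 <= F i h) -> (forall i, depends_on (D i) (F i)) ->
    (forall x, u x != v x) ->
    (forall x i, (x \in D i) = (i == u x) || (i == v x)) ->
  psum A g (fun h => \prod_i Num.sqrt (F i h))
    <= \prod_i Num.sqrt (psum (A :&: D i) g (F i)).
Proof.
move=> F0 dF uv DE; have [k] := ubnP #|A|.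
elim: k A g => // k IH A g; rewrite ltnS => Ak.
have [->|[x xA]] := set_0Vmem A.
  by rewrite psum0 ler_prod// => i _; rewrite sqrtr_ge0 set0I psum0/=.
have Ax : x \notin A :\ x by rewrite !inE eqxx.
have kx : (#|A :\ x| < k)%N by move: Ak; rewrite (cardsD1 x) xA.
rewrite -(setD1K xA) psumU1//.
have Du : x \in D (u x) by rewrite DE eqxx.
have Dv : x \in D (v x) by rewrite DE eqxx orbT.
have vu : v x != u x by rewrite eq_sym.
(* Summing out [x] affects only the factors [u x] and [v x]; all others are constant in the value
   [c] of [x]. *)
have in1 i : x \in D i ->
    psum ((x |: A :\ x) :&: D i) g (F i) =
    \sum_c psum ((A :\ x) :&: D i) (update g x c) (F i).
  move=> xD; rewrite setIUl.
  have /setIidPl -> : [set x] \subset D i by rewrite sub1set.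
  by rewrite psumU1// !inE eqxx.
have out1 i c : x \notin D i ->
    psum ((A :\ x) :&: D i) (update g x c) (F i) =
    psum ((x |: A :\ x) :&: D i) g (F i).
  move=> xD; rewrite setIUl.
  have -> : [set x] :&: D i = set0.
    by apply/setP => y; rewrite !inE; case: eqVneq => // ->; apply/negbTE.
  rewrite set0U; apply: (eq_psum _ (dF i)); first exact: subsetIr.
  move=> y yD; rewrite ffunE; case: eqVneq => // yx.
  by rewrite yx (negbTE xD) in yD.
apply: (le_trans (ler_sum _ (fun c _ => IH _ (update g x c) kx))).
rewrite [leRHS](bigD1 (u x))//= [X in _ * X](bigD1 (v x))//= mulrA.
under eq_bigr => c _.
  rewrite (bigD1 (u x))//= [X in _ * X](bigD1 (v x))//= mulrA.
  rewrite [X in _ * X](eq_bigr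
    (fun i => Num.sqrt (psum ((x |: A :\ x) :&: D i) g (F i)))); last first.
    by move=> i /andP[iu iv]; rewrite out1// DE negb_or iu.
  over.
rewrite -mulr_suml ler_wpM2r//.
  by apply: prodr_ge0 => i _; exact: sqrtr_ge0.
rewrite !in1//; apply: cauchy_schwarz_sqrt => c; exact: psum_ge0.
Qed.

End PartialSums.

(** The variable [g x] occurs in the factor of [x] and in that of its preimage under [s], which is
    the situation of [finner]. *)
Lemma sum_prod_perm_le (R : rcfType) (V C : finType) (s : V -> V)
    (M : V -> C -> C -> R) (c0 : C) :
    injective s -> (forall e a b, 0 <= M e a b) ->
  \sum_(g : {ffun V -> C}) \prod_e M e (g e) (g (s e))
    <= \prod_e (if s e == e then \sum_a M e a a
                else Num.sqrt (\sum_a \sum_b M e a b ^+ 2)).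
Proof.
move=> sI M0.
(* Two factors per e: a fixed e splits as sqrt (M e a a) * sqrt (M e a a), a
   moved one as M * 1. *)
pose D (i : V * bool) : {set V} :=
  if i.2 then if s i.1 == i.1 then [set i.1] else set0 else [set i.1; s i.1].
pose F (i : V * bool) (h : {ffun V -> C}) : R :=
  if s i.1 == i.1 then M i.1 (h i.1) (h i.1)
  else if i.2 then 1 else M i.1 (h i.1) (h (s i.1)) ^+ 2.
pose u (x : V) := (x, false).
(* At a fixed point the second occurrence is the second copy of the same factor; elsewhere it is the
   factor of the preimage. *)
pose v (x : V) := if s x == x then (x, true) else (invF sI x, false).
have F0 i h : 0 <= F i h.
  by rewrite /F; case: ifP => // _; case: ifP => // _; exact: sqr_ge0.
have dF i : depends_on (D i) (F i).
  case: i => e [] g h; rewrite /D /F /=; case: (eqVneq (s e) e) => // se gh.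
  - by rewrite gh// inE.
  - by rewrite gh// !inE eqxx.
  - by rewrite !gh// !inE eqxx ?orbT.
have uv x : u x != v x.
  rewrite /u /v; case: ifPn => [_|sx]; first by rewrite xpair_eqE andbF.
  rewrite xpair_eqE andbT; apply: contra sx => /eqP {1}->.
  by rewrite f_invF.
have DE x i : (x \in D i) = (i == u x) || (i == v x).
  case: i => e []; rewrite /D /u /v /= xpair_eqE ?andbF ?andbT /=.
    case: (eqVneq (s x) x) => sx; rewrite xpair_eqE ?andbT ?andbF.
      case: (eqVneq (s e) e) => se; rewrite !inE ?(eq_sym e)//.
      by apply/esym/negbTE; apply: contra se => /eqP <-; exact/eqP.
    case: (eqVneq (s e) e) => se; rewrite !inE//.
    by apply/negbTE; apply: contra sx => /eqP ->; exact/eqP.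
  rewrite !inE (eq_sym e); case: (eqVneq x e) => //= xe.
  case: (eqVneq (s x) x) => sx; rewrite xpair_eqE ?andbT ?andbF.
    by apply/negbTE; apply: contra xe; rewrite -{1}sx (inj_eq sI).
  by apply/eqP/eqP => [->|->]; rewrite ?invF_f ?f_invF.
have g0 : {ffun V -> C} := [ffun=> c0].
have := finner setT g0 F0 dF uv DE.
rewrite psumT.
rewrite (eq_bigr (fun g : {ffun V -> C} => \prod_e M e (g e) (g (s e)))); last first.
  move=> g _; rewrite -(pair_bigA _ (fun e b => Num.sqrt (F (e, b) g))) /=.
  apply: eq_bigr => e _; rewrite big_bool /F /=; case: ifPn => [/eqP ->|_].
    by rewrite -expr2 sqr_sqrtr.
  by rewrite sqrtr1 mul1r sqrtr_sqr ger0_norm.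
move=> /le_trans; apply.
rewrite -(pair_bigA _ (fun e b =>
  Num.sqrt (psum (setT :&: D (e, b)) g0 (F (e, b))))) /=.
apply: ler_prod => e _; rewrite big_bool !setTI /D /F /=.
rewrite mulr_ge0 ?sqrtr_ge0//=; case: ifPn => [/eqP se|se].
  rewrite se setUid !psum1 -expr2 sqr_sqrtr ?sumr_ge0//.
  by apply: ler_sum => a _; rewrite ffunE eqxx.
rewrite psum0 sqrtr1 mul1r psumU1 ?inE 1?eq_sym// ler_wsqrtr//.
apply: ler_sum => a _; rewrite psum1; apply: ler_sum => b _.
by rewrite !ffunE !eqxx [e == _]eq_sym (negbTE se).
Qed.

Lemma sqrtr_prod (R : rcfType) (I : finType) (F : I -> R) :
  (forall i, 0 <= F i) -> Num.sqrt (\prod_i F i) = \prod_i Num.sqrt (F i).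
Proof.
move=> F0; apply: (big_rec2 (fun x y => Num.sqrt x = y)); first exact: sqrtr1.
by move=> i x y _ <-; rewrite sqrtrM.
Qed.

(** * The Bhattacharyya coefficient of a relabeled pair *)

Section Bhattacharyya.
Variable R : realType.
Implicit Type P : bool * bool -> R.

Definition overlap P (a b : bool) : R :=
  \sum_c Num.sqrt (P (c, a)) * Num.sqrt (P (c, b)).

Lemma overlap_ge0 P a b : 0 <= overlap P a b.
Proof. by apply: sumr_ge0 => c _; rewrite mulr_ge0 ?sqrtr_ge0. Qed.

Lemma is_pmf_bool2 P : is_pmf P ->
  P (true, true) + P (true, false) + P (false, true) + P (false, false) = 1.
Proof.
move=> [_ <-]; rewrite (eq_bigr (fun i => P (i.1, i.2))); last by case.
by rewrite -(pair_bigA _ (fun a b => P (a, b))) /= !big_bool /= !addrA.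
Qed.

Lemma overlap_trace P : is_pmf P -> \sum_a overlap P a a = 1.
Proof.
move=> hP; have P0 := hP.1; rewrite -(is_pmf_bool2 hP) /overlap !big_bool /=.
rewrite -!expr2 !sqr_sqrtr//; ring.
Qed.

(* [overlap P] is S^T S for S = (sqrt P_ab), and [psi P] is (det S)^2, so this
   is tr(N^2) = (tr N)^2 - 2 det N for N = S^T S. *)
Lemma overlap_frobenius P : is_pmf P ->
  \sum_a \sum_b overlap P a b ^+ 2 = 1 - 2 * psi P.
Proof.
move=> hP; have P0 := hP.1; have P1 := is_pmf_bool2 hP.
rewrite /psi !sqrtrM// /overlap !big_bool /=.
have s2 ab : P ab = Num.sqrt (P ab) ^+ 2 by rewrite sqr_sqrtr.
move: P1; rewrite {1}(s2 (true, true)) {1}(s2 (true, false)).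
rewrite {1}(s2 (false, true)) {1}(s2 (false, false)).
move: (Num.sqrt (P (true, true))) (Num.sqrt (P (true, false))).
move: (Num.sqrt (P (false, true))) (Num.sqrt (P (false, false))).
move=> c d a b P1.
(* Writing 1 as the square of the total mass makes the claim a homogeneous polynomial identity of
   degree 4. *)
rewrite -[X in _ = X - _](expr1n _ 2) -{1}P1; ring.
Qed.

Lemma psi_ge0 P : 0 <= psi P. Proof. exact: sqr_ge0. Qed.

Lemma psi_le P : is_pmf P -> 2 * psi P <= 1.
Proof.
move=> hP; rewrite -subr_ge0 -(overlap_frobenius hP).
by apply: sumr_ge0 => a _; apply: sumr_ge0 => b _; exact: sqr_ge0.
Qed.

(** For fixed [g.2] the sum over [g.1] factorizes edge by edge into overlaps, so [sum_prod_perm_le]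
    applies; fixed edges contribute the trace 1. *)
Lemma bhattacharyya_le (V : finType) (law : V -> bool * bool -> R) (s : V -> V) :
    injective s -> (forall e, is_pmf (law e)) ->
  \sum_(g : {ffun V -> bool} * {ffun V -> bool})
     Num.sqrt ((\prod_e law e (g.1 e, g.2 e)) *
               (\prod_e law e (g.1 e, g.2 (s e))))
    <= \prod_(e | s e != e) Num.sqrt (1 - 2 * psi (law e)).
Proof.
move=> sI hlaw; have l0 e ab : 0 <= law e ab by have [] := hlaw e.
pose N e := overlap (law e).
have -> : \prod_(e | s e != e) Num.sqrt (1 - 2 * psi (law e)) =
    \prod_e (if s e == e then \sum_a N e a a
             else Num.sqrt (\sum_a \sum_b N e a b ^+ 2)).
  rewrite big_mkcond; apply: eq_bigr => e _; rewrite /N if_neg.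
  by rewrite overlap_trace// overlap_frobenius.
apply: le_trans (sum_prod_perm_le true sI (fun e a b => overlap_ge0 _ a b)).
rewrite le_eqVlt; apply/orP; left; apply/eqP.
rewrite -(pair_bigA _ (fun g1 g2 : {ffun V -> bool} => Num.sqrt
  ((\prod_e law e (g1 e, g2 e)) * (\prod_e law e (g1 e, g2 (s e)))))) /=.
rewrite exchange_big; apply: eq_bigr => g2 _ /=.
rewrite bigA_distr_bigA; apply: eq_bigr => g1 _ /=.
by rewrite sqrtrM ?prodr_ge0// !sqrtr_prod// big_split.
Qed.

End Bhattacharyya.

(** * Counting moved users, moved edges and permutations *)

Section MovedPoints.
Variable n : nat.
Implicit Type s : 'S_n.

Definition moved s : {set 'I_n} := [set i | s i != i].

(** The point [s i] lies in the image but not in the pair. *)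
Lemma imset2_neq s (i j : 'I_n) : s i != i -> j != i -> j != s i ->
  s @: [set i; j] != [set i; j].
Proof.
move=> si ji jsi; apply/eqP => /setP /(_ (s i)).
rewrite imset_f ?inE ?eqxx// (negbTE si) eq_sym.
by rewrite eq_sym (eq_sym (s i)) (negbTE jsi).
Qed.

(* Double counting of the incidences between moved users and moved edges: if
   user i is moved, then {i, j} is moved for every j other than i and s i. *)
Lemma moved_user_edges s :
  (#|moved s| * (n - 2) <= 2 * #|[pred e : user_edge n | s @: val e != val e]|)%N.
Proof.
pose W := [set A : {set 'I_n} | (#|A| == 2) && (s @: A != A)].
have -> : #|[pred e : user_edge n | s @: val e != val e]| = #|W|.
  rewrite -(card_imset _ val_inj) -cardsE; apply: eq_card => A; rewrite !inE.
  apply/imsetP/andP => [[e + ->]|[A2 sA]]; first by rewrite inE (valP e).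
  by exists (exist _ A A2); rewrite ?inE.
have -> : (2 * #|W| = \sum_(A in W) \sum_(i in A) 1)%N.
  rewrite mulnC -sum_nat_const; apply: eq_bigr => A.
  rewrite inE => /andP[/eqP A2 _]; by rewrite sum1_card A2.
rewrite (exchange_big_dep xpredT)//= -sum_nat_const [leqRHS](bigID (mem (moved s))).
apply: leq_trans (leq_addr _ _); apply: leq_sum => i; rewrite inE => si.
rewrite sum1_card.
have <- : #|~: [set i; s i]| = (n - 2)%N.
  by rewrite cardsCs setCK card_ord cards2 eq_sym si.
have inj : {in ~: [set i; s i] &, injective (fun j => [set i; j])}.
  move=> j k; rewrite !inE !negb_or => /andP[ji _] /andP[ki _] /setP /(_ j).
  by rewrite !inE eqxx (negbTE ji) /= => /esym/eqP.
rewrite -(card_in_imset inj); apply/subset_leq_card/subsetP => A.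
case/imsetP => j; rewrite !inE negb_or => /andP[ji jsi] ->.
by rewrite unfold_in !inE cards2 (eq_sym i) ji imset2_neq// eqxx.
Qed.

Lemma card_moved_attribute_edges m s :
  #|[pred e : 'I_n * 'I_m | s e.1 != e.1]| = (#|moved s| * m)%N.
Proof.
rewrite -[m in RHS]card_ord -cardsT -cardsX; apply: eq_card => -[i a].
by rewrite !inE /= andbT.
Qed.

Lemma perm_on_moved s : perm_on (moved s) s.
Proof. by apply/subsetP => i; rewrite !inE. Qed.

Lemma moved_eq0 s : (moved s == set0) = (s == 1%g).
Proof.
apply/eqP/eqP => [H|->]; last by apply/setP => i; rewrite !inE perm1 eqxx.
apply/permP => i; rewrite perm1; apply/eqP/negPn.
by have /setP/(_ i) := H; rewrite !inE => ->.
Qed.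

(** At most [k!] permutations have a given moved set of size [k], and there are ['C(n, k)] such
    sets; the product is a falling factorial, at most [n ^ k]. *)
Lemma sum_expr_moved (R : realFieldType) (x : R) : 0 <= x ->
  \sum_(s : 'S_n | s != 1%g) x ^+ #|moved s|
    <= \sum_(k < n) (n%:R * x) ^+ k.+1.
Proof.
move=> x0.
rewrite (partition_big moved (fun A => A != set0)); last first.
  by move=> s; rewrite moved_eq0.
apply: (@le_trans _ _ (\sum_(A : {set 'I_n} | A != set0) (#|A|`!)%:R * x ^+ #|A|)).
  apply: ler_sum => A _.
  rewrite -card_perm -[#|perm_on A|]sum1_card natr_sum mulr_suml.
  rewrite big_mkcond [leRHS]big_mkcond; apply: ler_sum => s _ /=.
  case: ifPn => [/andP[_ /eqP <-]|_].
    by rewrite [_ \in _]perm_on_moved mul1r.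
  by case: ifP => // _; rewrite mul1r exprn_ge0.
pose size_of (A : {set 'I_n}) : 'I_n.+1 := inord #|A|.
have size_ofE A : val (size_of A) = #|A|.
  by rewrite /= inordK// ltnS -[n in leqRHS]card_ord max_card.
rewrite (partition_big size_of (fun k => k != ord0)); last first.
  by move=> A A0; rewrite -val_eqE size_ofE /= cards_eq0.
rewrite big_mkcond big_ord_recl /= add0r; apply: ler_sum => k _.
rewrite (eq_bigr (fun=> (k.+1`!)%:R * x ^+ k.+1)); last first.
  by move=> A /andP[_ /eqP Ak]; rewrite -size_ofE Ak.
rewrite sumr_const -[leLHS]mulr_natl mulrA -natrM exprMn ler_wpM2r ?exprn_ge0//.
rewrite -natrX ler_nat.
apply: (@leq_trans ('C(n, k.+1) * k.+1`!)).
  rewrite leq_mul2r -[n in 'C(n, _)]card_ord -card_draws.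
  rewrite subset_leq_card ?orbT//.
  apply/subsetP => A; rewrite !inE unfold_in => /andP[_ /eqP Ak].
  by rewrite -size_ofE Ak.
rewrite bin_ffact ffact_prod -[k.+1 in leqRHS]card_ord -prod_nat_const.
by apply: leq_prod => i _; exact: leq_subr.
Qed.

End MovedPoints.

Lemma geometric_le (R : realFieldType) (y : R) n : 0 <= y -> y <= 2^-1 ->
  \sum_(k < n) y ^+ k.+1 <= 2 * y.
Proof.
(* The extra tail term makes the induction work: [y + 2 * y ^ 2 <= 2 * y] for [0 <= y <= 1/2]. *)
move=> y0 y2; suff : \sum_(k < n) y ^+ k.+1 + 2 * y ^+ n.+1 <= 2 * y.
  by apply: le_trans; rewrite lerDl mulr_ge0// exprn_ge0.
elim: n => [|n IH]; first by rewrite big_ord0 add0r.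
apply: le_trans IH; rewrite big_ord_recr/= -addrA lerD2l.
have : y * y ^+ n.+1 <= 2^-1 * y ^+ n.+1 by rewrite ler_wpM2r ?exprn_ge0.
rewrite [y ^+ n.+2]exprS; move: (y ^+ n.+1) => z; lra.
Qed.

(** * Relabeling as a group action on edges and graphs *)

Section Relabeling.
Variables n m : nat.
Implicit Types (s t : 'S_n) (e : edge n m) (g : graph n m).

Lemma relabel_edgeM s t e :
  relabel_edge (s * t)%g e = relabel_edge t (relabel_edge s e).
Proof.
case: e => [u|[i a]] /=; last by rewrite permM.
congr inl; apply: val_inj => /=.
by rewrite -imset_comp; apply: eq_imset => i; rewrite /= permM.
Qed.

Lemma relabel_edge1 e : relabel_edge 1%g e = e.
Proof.
case: e => [u|[i a]] /=; last by rewrite perm1.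
congr inl; apply: val_inj => /=.
by rewrite -[RHS]imset_id; apply: eq_imset => i; rewrite perm1.
Qed.

Lemma relabel_edge_inj s : injective (@relabel_edge n m s).
Proof.
by apply: (can_inj (g := relabel_edge s^-1)) => e;
  rewrite -relabel_edgeM mulgV relabel_edge1.
Qed.

Lemma relabelM s t g : relabel (s * t)%g g = relabel t (relabel s g).
Proof. by apply/ffunP => e; rewrite !ffunE invMg relabel_edgeM. Qed.

Lemma relabel1 g : relabel 1%g g = g.
Proof. by apply/ffunP => e; rewrite ffunE invg1 relabel_edge1. Qed.

Lemma relabelK s : cancel (@relabel n m s) (relabel s^-1).
Proof. by move=> g; rewrite -relabelM mulgV relabel1. Qed.

Lemma relabelKV s : cancel (@relabel n m s^-1) (relabel s).
Proof. by move=> g; rewrite -relabelM mulVg relabel1. Qed.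

End Relabeling.

(** * From the MAP rule to Bhattacharyya coefficients *)

Section ErrorProbability.
Variables (R : realType) (n m : nat) (p q : bool * bool -> R).
Hypotheses (hp : is_pmf p) (hq : is_pmf q).

Let aER_ge0 (w : outcome n m) : 0 <= aER p q w.
Proof. exact: (aER_pmf n m hp hq).1. Qed.

Lemma edge_law_pmf (e : edge n m) : is_pmf (edge_law p q e).
Proof. by case: e. Qed.

(** Given the observation, a permutation determines [G2], so each posterior numerator is the mass of
    a single outcome, and the denominators agree. *)
Lemma MAP_aER (pihat : estimator n m) (g1 g2 : graph n m) (s t : 'S_n) :
    is_MAP p q pihat -> t = pihat g1 (relabel s g2) ->
  aER p q (g1, g2, s) <= aER p q (g1, relabel t^-1 (relabel s g2), t).
Proof.
move=> + tE => /(_ g1 (relabel s g2) s); rewrite /posterior /cPr -tE.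
set B := fun w : outcome n m => (G1 w == g1) && _.
have num u : Pr (aER p q) (predI (fun w => Pi w == u) B) =
    aER p q (g1, relabel u^-1 (relabel s g2), u).
  rewrite /Pr (big_pred1 (g1, relabel u^-1 (relabel s g2), u))//.
  case=> [[h1 h2] v]; change ([&& v == u, h1 == g1 & relabel v h2 == relabel s g2] =
    ((h1, h2, v) == (g1, relabel u^-1 (relabel s g2), u))).
  rewrite !xpair_eqE.
  apply/and3P/andP => [[/eqP -> /eqP -> /eqP <-]|[/andP[/eqP -> /eqP ->] /eqP ->]].
    by rewrite relabelK !eqxx.
  by rewrite relabelKV !eqxx.
rewrite !num relabelK.
(* An observation of probability 0 makes all posteriors 0, but then the outcome on the left has mass
   0 too. *)
have [B0 _|B0] := eqVneq (Pr (aER p q) B) 0; last first.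
  by rewrite ler_pM2r// invr_gt0 lt_def B0 sumr_ge0.
suff -> : aER p q (g1, g2, s) = 0 by [].
apply: (psumr_eq0P _ B0) => //.
by rewrite /B /Pi /G1 /G2' /G2 /= !eqxx.
Qed.

Lemma error_probability_le (pihat : estimator n m) : is_MAP p q pihat ->
  error_probability p q pihat <= \sum_(t : 'S_n | t != 1%g)
    \prod_(e : edge n m | relabel_edge t e != e)
      Num.sqrt (1 - 2 * psi (edge_law p q e)).
Proof.
move=> hMAP.
(* The outcome with the same observation as [w] and permutation [t * Pi w]. *)
pose other (w : outcome n m) t : outcome n m :=
  (w.1.1, relabel (t * w.2)^-1 (relabel w.2 w.1.2), (t * w.2)%g).
apply: (@le_trans _ _ (\sum_w \sum_(t : 'S_n | t != 1%g)
    Num.sqrt (aER p q w * aER p q (other w t)))).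
  rewrite /error_probability /Pr big_mkcond; apply: ler_sum => -[[g1 g2] s] _ /=.
  rewrite /Pi /G1 /G2' /G2 /=; case: ifPn => [err|_]; last first.
    by apply: sumr_ge0 => t _; exact: sqrtr_ge0.
  (* On an error, the single term whose [t] turns the true permutation into the answer already
     dominates the mass of [w]. *)
  rewrite (bigD1 (pihat g1 (relabel s g2) * s^-1)%g) /=; last first.
    by rewrite -eq_mulgV1.
  rewrite -[leLHS]addr0 lerD ?sumr_ge0//; last by move=> t _; exact: sqrtr_ge0.
  rewrite -[leLHS]ger0_norm// -sqrtr_sqr ler_wsqrtr// expr2 ler_wpM2l//.
  by rewrite /other /= mulgKV; exact: MAP_aER.
rewrite exchange_big /=; apply: ler_sum => t _.
apply: le_trans (bhattacharyya_le (@relabel_edge_inj n m t) edge_law_pmf).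
rewrite -(pair_bigA _ (fun g s =>
  Num.sqrt (aER p q (g, s) * aER p q (other (g, s) t)))) /=.
apply: ler_sum => -[g1 g2] _.
(* The relabelings by [s] cancel, leaving a term that depends on [s] no more; summing over [s] then
   absorbs the factor [1 / n!]. *)
have E s : Num.sqrt (aER p q (g1, g2, s) * aER p q (other (g1, g2, s) t)) =
    Num.sqrt ((\prod_e edge_law p q e (g1 e, g2 e)) *
      (\prod_e edge_law p q e (g1 e, g2 (relabel_edge t e)))) / (n`!)%:R.
  rewrite /aER /G1 /G2 /= mulrACA -expr2 sqrtrM; last first.
    by rewrite mulr_ge0 ?prodr_ge0// => e _; case: (edge_law_pmf e).
  rewrite sqrtr_sqr ger0_norm ?invr_ge0 ?ler0n//.
  congr (Num.sqrt (_ * _) * _); apply: eq_bigr => e _.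
  by rewrite !ffunE invgK -relabel_edgeM mulgK.
rewrite (eq_bigr _ (fun s _ => E s)) sumr_const card_Sn -[leLHS]mulr_natr.
by rewrite -mulrA mulVf ?mulr1// pnatr_eq0 -lt0n fact_gt0.
Qed.

End ErrorProbability.

(* Imported only here because [classical_sets] takes over the finset notations. *)
From mathcomp Require Import classical_sets reals topology normedtype sequences exp.

Import numFieldNormedType.Exports.
Local Open Scope classical_set_scope.
Local Open Scope ring_scope.

(** * Exponential bounds and the limit *)

Lemma sqrt_pmf_le (R : realType) (P : bool * bool -> R) :
  Num.sqrt (1 - 2 * psi P) <= expR (- psi P).
Proof.
rewrite -[leRHS]ger0_norm ?expR_ge0// -sqrtr_sqr ler_wsqrtr//.
rewrite -expRM_natl; apply: le_trans (expR_ge1Dx _).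
by rewrite mulrN.
Qed.

Lemma prod_moved_edges_le (R : realType) n m (p q : bool * bool -> R) (t : 'S_n) :
    (2 <= n)%N ->
  \prod_(e : edge n m | relabel_edge t e != e)
      Num.sqrt (1 - 2 * psi (edge_law p q e))
    <= expR (- ((n%:R / 2 - 1) * psi p + m%:R * psi q)) ^+ #|moved t|.
Proof.
move=> n2.
apply: (@le_trans _ _ (\prod_(e : edge n m | relabel_edge t e != e)
    expR (- psi (edge_law p q e)))).
  by apply: ler_prod => e _; rewrite sqrtr_ge0 sqrt_pmf_le.
rewrite big_sumType /= !prodr_const.
rewrite -![expR _ ^+ _]expRM_natl -expRD ler_expR.
have := moved_user_edges t; have := card_moved_attribute_edges m t.
set u := #|_|; set a := #|_|; set b := #|_|; set c := #|_|.
(* An attribute edge is moved exactly when its user is. *)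
have -> : b = c.
  apply: eq_card => -[i j].
  by rewrite !inE unfold_in -!sum_eqE /= xpair_eqE eqxx andbT.
move=> -> au; have : (u * (n - 2))%:R <= (2 * a)%:R :> R by rewrite ler_nat.
rewrite !natrM natrB// => /(ler_wpM2r (psi_ge0 p)).
move: (psi p) (psi q) => x y; lra.
Qed.

Theorem theorem1 (R : realType) (m : nat -> nat)
    (p q : nat -> bool * bool -> R)
    (hp : forall n, is_pmf (p n)) (hq : forall n, is_pmf (q n))
    (hcorr : forall n, edges_pos_correlated n (m n) (p n) (q n))
    (hlim : (2^-1 * n%:R * psi (p n) + (m n)%:R * psi (q n) - ln (n%:R : R))
              @[n --> \oo] --> +oo)
    (pihat : forall n, estimator n (m n))
    (hMAP : forall n, is_MAP (p n) (q n) (pihat n)) :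
  error_probability (p n) (q n) (pihat n) @[n --> \oo] --> (0 : R).
Proof.
set h := (X in X @ _ --> _) in hlim.
have bound n : (2 <= n)%N -> expR 1 * expR (- h n) <= 2^-1 ->
    0 <= error_probability (p n) (q n) (pihat n)
      <= 2 * (expR 1 * expR (- h n)).
  move=> n2 small; apply/andP; split.
    by apply: sumr_ge0 => w _; exact: (aER_pmf _ _ (hp n) (hq n)).1.
  apply: (le_trans (error_probability_le (hp n) (hq n) (hMAP n))).
  apply: (le_trans (ler_sum _ (fun t _ => prod_moved_edges_le (m n) (p n) (q n) t n2))).
  set x := expR _.
  apply: (le_trans (sum_expr_moved _ (expR_ge0 _))); rewrite -/x.
  (* Having [n / 2 - 1] in place of [n / 2] costs [psi (p n) <= 1/2] in the exponent, covered by the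
     factor [expR 1]. *)
  have nx : n%:R * x <= expR 1 * expR (- h n).
    rewrite -[n%:R]lnK ?posrE ?ltr0n ?(leq_trans _ n2)// -!expRD ler_expR /h.
    have := psi_le (hp n); have := psi_ge0 (p n); lra.
  have nx0 : 0 <= n%:R * x by rewrite mulr_ge0 ?expR_ge0.
  apply: (le_trans (geometric_le _ nx0 (le_trans nx small))).
  by rewrite ler_pM2l.
have y0 : expR 1 * expR (- h n) @[n --> \oo] --> (0 : R).
  rewrite -[X in _ --> X](mulr0 (expR 1)); apply: cvgMr.
  exact: (cvg_comp _ _ hlim (@cvgr_expR R)).
(* Eventually [n >= 2] and the ratio is at most 1/2, so [bound] traps the error between 0 and twice
   the ratio. *)
apply: (@squeeze_cvgr _ _ _ _ (fun=> 0) (fun n => 2 * (expR 1 * expR (- h n)))).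
- near=> n; apply: bound; first by near: n; exact: nbhs_infty_ge.
  near: n; apply: (cvgr_le 0 y0); by rewrite invr_gt0.
- exact: cvg_cst.
- by rewrite -[X in _ --> X](mulr0 2); apply: cvgMr.
Unshelve. all: end_near.
Qed.
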